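(* Let $c(x,y)=\sin(\pi(x+y))$ for $x,y\in[0,1]$. Let $\beta\in(0,1)$, $\beta\approx 0.7541996008265638$, be the solution of $$\sin(2\pi\beta)-\sin(\pi\beta)=\beta\pi\cos(\pi\beta),$$ let $$\Gamma(x)=\begin{cases}\beta-x, & x\in[0,\beta),\\ x, & x\in[\beta,1],\end{cases}$$ and let $U$ be uniformly distributed on $[0,1]$. Then the distribution of the random vector $(U,\Gamma(U))$ maximizes $$\int_{[0,1]^2}\sin(\pi(x+y))\,\gamma(dx,dy)$$ over the set of all Borel probability measures $\gamma$ on $[0,1]^2$ with uniform marginals, i.e. over the set of all copulas.
   Context: A Borel probability measure $\gamma$ on $[0,1]^2$ has uniform marginals if $\gamma(A\times[0,1])=\gamma([0,1]\times A)=\lambda(A)$ for every Borel set $A\subseteq[0,1]$, where $\lambda$ is Lebesgue measure. Such measures are identified with copulas, i.e. with their bivariate distribution functions $C(u,v)=\gamma([0,u]\times[0,v])$. *)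

(* Defs.v *)
From HB Require Import structures.
From mathcomp Require Export all_boot all_order all_algebra.
From mathcomp Require Export all_classical all_reals all_analysis.
From mathcomp Require Export measurable_realfun.

Set Implicit Arguments.
Unset Strict Implicit.
Unset Printing Implicit Defensive.

Import Order.TTheory GRing.Theory Num.Theory.
Import numFieldNormedType.Exports.

Local Open Scope classical_set_scope.
Local Open Scope ring_scope.

Definition unit_square (R : realType) : set (R * R) :=
  [set` `[(0 : R), 1]] `*` [set` `[(0 : R), 1]].

(* Borel measures on the unit square are represented by Borel measures on the
   plane that give full mass to the square. *)
Definition uniform_marginals (R : realType)
    (gamma : probability (R * R)%type R) : Prop :=
  gamma (@unit_square R) = 1%E /\
  forall A : set R, measurable A -> A `<=` `[0, 1] ->
    gamma (A `*` [set` `[(0 : R), 1]]) = lebesgue_measure A /\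
    gamma ([set` `[(0 : R), 1]] `*` A) = lebesgue_measure A.

Definition cost (R : realType) (x y : R) : R := sin (pi * (x + y)).

Definition beta_spec (R : realType) (b : R) : Prop :=
  0 < b < 1 /\ sin (2 * pi * b) - sin (pi * b) = b * pi * cos (pi * b).

(* Only the values on [0, 1] matter; the extension by the identity outside
   [0, 1] makes it a function on the whole line. *)
Definition Gamma (R : realType) (b x : R) : R :=
  if 0 <= x < b then b - x else x.

Definition random_vector d (T : measurableType d) (R : realType) (b : R)
  (U : {mfun T >-> R}) : T -> R * R := fun w => (U w, Gamma b (U w)).

Lemma measurable_Gamma (R : realType) (b : R) :
  measurable_fun [set: R] (Gamma b).
Proof.
apply: measurable_fun_ifT => //.
- by apply: measurable_and; [exact: measurable_fun_ler|exact: measurable_fun_ltr].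
- exact: measurable_funB.
Qed.

Lemma measurable_random_vector d (T : measurableType d) (R : realType) (b : R)
  (U : {mfun T >-> R}) : measurable_fun [set: T] (random_vector b U).
Proof.
apply: measurable_fun_pair => //.
by apply: measurableT_comp => //; exact: measurable_Gamma.
Qed.

HB.instance Definition _ d (T : measurableType d) (R : realType) (b : R)
  (U : {mfun T >-> R}) :=
  isMeasurableFun.Build _ _ _ _ (random_vector b U)
    (measurable_random_vector b U).

(* Main.v *)
Require Import Defs.
From mathcomp Require Import all_boot all_order all_algebra.
From mathcomp Require Import all_classical all_reals all_analysis.
From mathcomp Require Import ring lra.
Import Order.TTheory GRing.Theory Num.Theory.
Import numFieldNormedType.Exports.
Local Open Scope classical_set_scope.
Local Open Scope ring_scope.

(** The optimality is certified by a Kantorovich dual potential. With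
    [t = pi * beta], let [h] be affine on [[0, t]] and equal to
    [sin (2 * x) / 2] on [[t, pi]], the affine part being such that
    [h x + h (t - x) = sin t] and [h' = cos t]. The equation defining [beta] says exactly that [h] is
    continuous at [t]. Then [h x + h y >= sin (x + y)] on [[0, pi]^2], with
    equality on the rescaled graph of [Gamma]: on [[0, t]^2] because the tangent
    to [sin] at [t] meets [sin] again at [2 * t], on [[t, pi]^2] by the
    sum-to-product formula, and on the mixed rectangle by monotonicity in [x] on
    either side of [x + y = 2 * pi - t]. Since the integral of
    [h (pi * x) + h (pi * y)] only depends on the marginals, this bounds every
    copula by the law of [(U, Gamma U)].

    Writing [F t = sin (2 * t) - sin t - t * cos t], every zero of [F] in
    [(0, pi)] satisfies [cos t < - 1 / 2], and [F] is increasing where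
    [cos t <= - 1 / 2]; hence uniqueness, and the numerical value follows from
    two sign evaluations of [F] with Maclaurin bounds. *)

Set Implicit Arguments.
Unset Strict Implicit.
Unset Printing Implicit Defensive.

(* Large literals are stored as [Nat.of_num_uint _]; simplification would
   expand them into unary numbers. *)
#[local] Arguments Nat.of_num_uint : simpl never.

Section Potential.
Context {R : realType}.
Implicit Types (f df : R -> R) (a b c t x y z : R).

(** * Rational enclosures of sine, cosine and [pi] *)

Lemma le_of_derive_ge0 f df a b : (forall x, is_derive x 1 f (df x)) ->
  a <= b -> (forall x, a < x < b -> 0 <= df x) -> f a <= f b.
Proof.
move=> fdf ab df0.
apply: (@ger0_derive1_ndecr R f a b) => // [x xab|].
- by rewrite derive1E derive_val df0 // -in_itv.
- by apply: derivable_within_continuous => x _; case: (fdf x).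
Qed.

Lemma ge_of_derive_le0 f df a b : (forall x, is_derive x 1 f (df x)) ->
  a <= b -> (forall x, a < x < b -> df x <= 0) -> f b <= f a.
Proof.
move=> fdf ab df0; rewrite -lerN2.
apply: (@le_of_derive_ge0 (- f) (fun x => - df x)) => // x xab.
by rewrite oppr_ge0 df0.
Qed.

(** An [n]-term alternating sum [x^k/k! - x^(k+2)/(k+2)! + ...]: the sine series for [k = 1], the
    cosine series for [k = 0]. A general [k] lets differentiation simply lower the index. *)
Fixpoint maclaurin n k x : R :=
  if n is m.+1 then x ^+ k / k`!%:R - maclaurin m k.+2 x else 0.

Lemma is_derive_maclaurin n k x :
  is_derive x 1 (maclaurin n k.+1) (maclaurin n k x).
Proof.
elim: n k => [|n IH] k /=; first exact: is_derive_cst.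
have dX : is_derive x 1 (fun x : R => x ^+ k.+1 / k.+1`!%:R) (x ^+ k / k`!%:R).
  have -> : (fun x : R => x ^+ k.+1 / k.+1`!%:R) =
      k.+1`!%:R^-1 \*: (@id R ^+ k.+1).
    by apply/funext => y; rewrite /= exprfctE /GRing.scale /= mulrC.
  apply: is_derive_eq; rewrite /GRing.scale /= factS natrM.
  have kf : k`!%:R != 0 :> R by rewrite pnatr_eq0 -lt0n fact_gt0.
  by field; rewrite kf nat1r pnatr_eq0.
exact: is_deriveB.
Qed.

Lemma maclaurin0 n k : maclaurin n k.+1 0 = 0 :> R.
Proof. by elim: n k => [//|n IH] k /=; rewrite IH exprS !mul0r subrr. Qed.

(* The partial sums of the alternating series are alternately upper and lower
   bounds, each bound being obtained by integrating the previous one. *)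
Lemma maclaurin_sin_cos n x : 0 <= x ->
  0 <= (-1) ^+ n * (maclaurin n.+1 1 x - sin x) /\
  0 <= (-1) ^+ n * (maclaurin n.+1 0 x - cos x).
Proof.
(* Half of each induction step: integrating a cosine bound gives a sine bound of the same sign.
   Integrating that one gives the next cosine bound, with the sign reversed. *)
have sin_of_cos m : (forall x, 0 <= x ->
    0 <= (-1) ^+ m * (maclaurin m.+1 0 x - cos x)) -> forall x, 0 <= x ->
    0 <= (-1) ^+ m * (maclaurin m.+1 1 x - sin x).
  move=> H y y0.
  pose f (x : R) : R := (-1) ^+ m * (maclaurin m.+1 1 x - sin x).
  have df z : is_derive z 1 f ((-1) ^+ m * (maclaurin m.+1 0 z - cos z)).
    have := is_deriveB (is_derive_maclaurin m.+1 0 z) (is_derive_sin z).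
    by move=> /(is_deriveZ ((-1) ^+ m)).
  have f0 : f 0 = 0 by rewrite /f maclaurin0 sin0 subrr mulr0.
  rewrite -[leLHS]f0; apply: (le_of_derive_ge0 df) => // z /andP[z0 _].
  exact/H/ltW.
have : forall x, 0 <= x -> 0 <= (-1) ^+ n * (maclaurin n.+1 0 x - cos x).
  elim: n {x} => [|n IH] x x0.
    by rewrite /= expr0 fact0 invr1 !mulr1 mul1r subr0 subr_ge0 cos_le1.
  have -> : maclaurin n.+2 0 x = 1 - maclaurin n.+1 2 x.
    by rewrite [LHS]/= expr0 fact0 divr1.
  pose f (x : R) : R := (-1) ^+ n.+1 * (1 - maclaurin n.+1 2 x - cos x).
  have df z : is_derive z 1 f ((-1) ^+ n * (maclaurin n.+1 1 z - sin z)).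
    have d1 := is_deriveB (is_derive_cst (1 : R) z 1)
      (is_derive_maclaurin n.+1 1 z).
    have := is_deriveZ ((-1) ^+ n.+1) (is_deriveB d1 (is_derive_cos z)).
    by move=> /is_derive_eq; apply; rewrite /GRing.scale /= exprS; ring.
  have f0 : f 0 = 0 by rewrite /f maclaurin0 cos0 subr0 subrr mulr0.
  rewrite -[leLHS]f0 -/(f x).
  apply: (le_of_derive_ge0 df) => // z /andP[z0 _].
  exact: sin_of_cos (ltW z0).
by move=> H x0; split; [exact: sin_of_cos|exact: H].
Qed.

(** Nested form in [z = x ^+ 2] with the leading term factored out; at a rational point it unfolds
    to arithmetic free of factorials, within reach of [lra]. *)
Fixpoint maclaurin_horner n k z : R :=
  if n is m.+1 then 1 - z / (k.+1 * k.+2)%:R * maclaurin_horner m k.+2 z else 0.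

Lemma maclaurinE n k x :
  maclaurin n k x = x ^+ k / k`!%:R * maclaurin_horner n k (x ^+ 2).
Proof.
elim: n k => [|n IH] k /=; first by rewrite mulr0.
rewrite IH mulrBr mulr1; congr (_ - _).
rewrite !factS !natrM !exprS.
have kf : k`!%:R != 0 :> R by rewrite pnatr_eq0 -lt0n fact_gt0.
by field; rewrite kf !nat1r -?natrD ?pnatr_eq0.
Qed.

Lemma maclaurin_horner_bounds n x : 0 <= x ->
  [/\ sin x <= x * maclaurin_horner n.*2.+1 1 (x ^+ 2),
      x * maclaurin_horner n.*2.+2 1 (x ^+ 2) <= sin x,
      cos x <= maclaurin_horner n.*2.+1 0 (x ^+ 2) &
      maclaurin_horner n.*2.+2 0 (x ^+ 2) <= cos x].
Proof.
move=> x0.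
have [] := maclaurin_sin_cos n.*2 x0; have [] := maclaurin_sin_cos n.*2.+1 x0.
rewrite exprS -muln2 exprM sqrr_sign !mulr1 !mul1r !mulN1r.
rewrite !oppr_ge0 !subr_le0 !subr_ge0.
by rewrite !maclaurinE expr0 expr1 !divr1 !mul1r => -[? ?] [? ?]; split.
Qed.

(** On [[0, pi / 2]] sine increases and cosine decreases, so truncated series at the endpoints
    suffice; at rational endpoints the four series hypotheses are purely rational. *)
Lemma sin_cos_enclosure n a b s s' c c' x :
  0 <= a -> b <= pi / 2 -> a <= x <= b ->
  s <= a * maclaurin_horner n.*2.+2 1 (a ^+ 2) ->
  b * maclaurin_horner n.*2.+1 1 (b ^+ 2) <= s' ->
  c <= maclaurin_horner n.*2.+2 0 (b ^+ 2) ->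
  maclaurin_horner n.*2.+1 0 (a ^+ 2) <= c' ->
  s <= sin x <= s' /\ c <= cos x <= c'.
Proof.
move=> a0 bpi /andP[ax xb] hs hs' hc hc'; have p0 := @pi_gt0 R.
have b0 : 0 <= b by lra.
have [_ sa ca _] := maclaurin_horner_bounds n a0.
have [sb _ _ cb] := maclaurin_horner_bounds n b0.
split; apply/andP; split.
- apply: le_trans hs (le_trans sa _).
  by rewrite leNgt ltr_sin ?in_itv/= -?leNgt//; apply/andP; split; lra.
- apply: le_trans (le_trans _ sb) hs'.
  by rewrite leNgt ltr_sin ?in_itv/= -?leNgt//; apply/andP; split; lra.
- apply: le_trans hc (le_trans cb _).
  by rewrite leNgt ltr_cos ?in_itv/= -?leNgt//; apply/andP; split; lra.
- apply: le_trans (le_trans _ ca) hc'.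
  by rewrite leNgt ltr_cos ?in_itv/= -?leNgt//; apply/andP; split; lra.
Qed.

(** Since cosine decreases through its zero [pi / 2], each bound follows from the sign of cosine at
    half the proposed value. *)
Lemma pi_bounds :
  3141592653589793237%:R / 10 ^+ 18 <= (pi : R) <=
  3141592653589793240%:R / 10 ^+ 18.
Proof.
have pi2 := @pi_ge2 R; have pi4 : (pi : R) < 4 by have := @pihalf_lt2 R; lra.
apply/andP; split; rewrite leNgt; apply/negP => h.
- pose q : R := 3141592653589793237%:R / (2 * 10 ^+ 18).
  have q0 : 0 <= q by rewrite /q; lra.
  have [_ _ _] := maclaurin_horner_bounds 6 q0.
  rewrite [maclaurin_horner _ _ _]/= => H.
  have : 0 < cos q by apply: lt_le_trans H; rewrite /q; lra.
  apply/negP; rewrite -leNgt -cos_pihalf.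
  by rewrite leNgt ltr_cos ?in_itv/= -?leNgt /q; try (apply/andP; split); lra.
- pose q : R := 3141592653589793240%:R / (2 * 10 ^+ 18).
  have q0 : 0 <= q by rewrite /q; lra.
  have [_ _ H _] := maclaurin_horner_bounds 6 q0.
  move: H; rewrite [maclaurin_horner _ _ _]/= => H.
  have : cos q < 0 by apply: le_lt_trans H _; rewrite /q; lra.
  apply/negP; rewrite -leNgt -cos_pihalf.
  by rewrite leNgt ltr_cos ?in_itv/= -?leNgt /q; try (apply/andP; split); lra.
Qed.

(** * The stationarity equation and the location of its roots *)

(* The function whose zero in [(0, pi)] is [pi * beta]. *)
Definition stationary t : R := sin (2 * t) - sin t - t * cos t.

Lemma is_derive_stationary t :
  is_derive t 1 stationary (2 * cos (2 * t) - 2 * cos t + t * sin t).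
Proof. by apply: trigger_derive; rewrite /GRing.scale /=; ring. Qed.

Lemma sin2x x : sin (2 * x) = 2 * (cos x * sin x).
Proof. by rewrite mulr_natl sin_mulr2n -mulr_natl. Qed.

Lemma cos2x x : cos (2 * x) = 2 * cos x ^+ 2 - 1.
Proof. by rewrite mulr_natl cos_mulr2n mulr_natl. Qed.

Lemma sin_le_id x : 0 <= x -> sin x <= x.
Proof.
move=> x0.
have := @le_of_derive_ge0 (fun x => x - sin x) (fun x => 1 - cos x) 0 x.
by rewrite sin0 subrr subr_ge0; apply.
Qed.

(** With [c = cos x], the derivative is [2 * (2 * c + 1) * (c - 1) + x * sin x], a sum of
    nonnegative terms once [c <= - (1 / 2)]. *)
Lemma stationary_le a b : 0 <= a -> a <= b -> b <= pi -> cos a <= - (1 / 2) ->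
  stationary a <= stationary b.
Proof.
move=> a0 ab bpi ca.
apply: (le_of_derive_ge0 is_derive_stationary) => // x /andP[ax xb].
have x0 : 0 <= x by lra.
have sx : 0 <= sin x by apply: sin_ge0_pi; apply/andP; split; lra.
have cx : cos x < cos a by rewrite ltr_cos// in_itv/=; apply/andP; split; lra.
rewrite cos2x; have := mulr_ge0 x0 sx; nra.
Qed.

Lemma stationary_lt a b : 0 <= a -> a < b -> b <= pi -> cos a <= - (1 / 2) ->
  stationary a < stationary b.
Proof.
move=> a0 ab bpi ca.
apply: (@gtr0_derive1_incr R stationary a b) => // [x|].
- rewrite in_itv/= derive1E => /andP[ax xb].
  have := is_derive_stationary x => ?; rewrite derive_val.
  have x0 : 0 <= x by lra.
  have sx : 0 <= sin x by apply: sin_ge0_pi; apply/andP; split; lra.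
  have cx : cos x < cos a by rewrite ltr_cos// in_itv/=; apply/andP; split; lra.
  rewrite cos2x; have := mulr_ge0 x0 sx; nra.
- by apply: derivable_within_continuous => x _; case: (is_derive_stationary x).
Qed.

(** The equation reads [sin t * (2 * cos t - 1) = t * cos t]. For [cos t > 1 / 2] the left side is
    smaller, by [sin t <= t]; for [cos t] in [[0, 1 / 2]] the sides have opposite signs and are not
    both zero; for [cos t] in [[- 1 / 2, 0)], the bounds [sin t > 0.86] and [t < 3.2] make the left
    side smaller again. *)
Lemma stationary_root_cos t : pi < 32 / 10 :> R -> 0 < t < pi ->
  stationary t = 0 -> cos t < - (1 / 2).
Proof.
move=> pi3 /andP[t0 tpi]; rewrite /stationary sin2x => e.
have st : 0 < sin t by apply: sin_gt0_pi; rewrite t0.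
have stt := sin_le_id (ltW t0).
have ct := cos_le1 t.
have sc := cos2Dsin2 t.
rewrite ltNge; apply/negP => ch.
have [c0|c0] := ltP (cos t) 0.
  have : sin t ^+ 2 >= 3 / 4 by nra.
  move=> s2; have s8 : sin t > 86 / 100 by nra.
  nra.
have [c1|c1] := leP (2 * cos t) 1; first by nra.
have ct1 : cos t < 1.
  rewrite lt_neqAle ct andbT; apply/eqP => c; rewrite c in sc; nra.
nra.
Qed.

(** * Dual feasibility of the potential *)

Lemma sin2D_ge x y : pi / 2 <= x <= pi -> pi / 2 <= y <= pi ->
  sin (x + y) <= sin (2 * x) / 2 + sin (2 * y) / 2.
Proof.
move=> /andP[x0 x1] /andP[y0 y1].
have -> : sin (2 * x) / 2 + sin (2 * y) / 2 = sin (x + y) * cos (x - y).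
  have -> : 2 * x = (x + y) + (x - y) by ring.
  have -> : 2 * y = (x + y) - (x - y) by ring.
  by rewrite (sinD (x + y) (x - y)) (sinB (x + y) (x - y)); field.
(* Multiplying a nonpositive number by a factor at most 1 cannot decrease it. *)
suff : sin (x + y) <= 0 by have := cos_le1 (x - y); nra.
have -> : x + y = (x + y - pi) + pi by ring.
by rewrite sinDpi oppr_le0; apply: sin_ge0_pi; apply/andP; split; lra.
Qed.

Lemma cos_le_between a x : 0 <= a <= pi -> a <= x <= 2 * pi - a ->
  cos x <= cos a.
Proof.
move=> /andP[a0 api] /andP[ax xa]; have [xp|xp] := leP x pi.
  by rewrite leNgt ltr_cos ?in_itv/= -?leNgt//; apply/andP; split; lra.
have -> : cos x = cos (2 * pi - x).
  by rewrite mulr_natl cosB cos2pi sin2pi; ring.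
by rewrite leNgt ltr_cos ?in_itv/= -?leNgt; try (apply/andP; split); lra.
Qed.

Lemma cos_ge_outside a x : 0 <= a <= pi -> 2 * pi - a <= x <= 2 * pi ->
  cos a <= cos x.
Proof.
move=> /andP[a0 api] /andP[ax xa].
have -> : cos x = cos (2 * pi - x).
  by rewrite mulr_natl cosB cos2pi sin2pi; ring.
by rewrite leNgt ltr_cos ?in_itv/= -?leNgt; try (apply/andP; split); lra.
Qed.

Definition potential t x : R :=
  if x <= t then sin t / 2 + cos t * (x - t / 2) else sin (2 * x) / 2.

(** At [x = t] the affine branch applies; its value [(sin t + t * cos t) / 2] is [sin (2 * t) / 2]
    by stationarity. *)
Lemma potential_ge_root t x : stationary t = 0 -> t <= x ->
  potential t x = sin (2 * x) / 2.
Proof.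
rewrite /potential /stationary => e tx; case: ifPn => // xt.
have -> : x = t by lra.
lra.
Qed.

(** The gap [K] vanishes at [t] and, by stationarity, at [2 * t]. It decreases up to [t], increases
    up to [2 * pi - t], then decreases down to its zero [2 * t]. *)
Lemma sin_le_tangent t s : pi / 2 <= t <= pi -> stationary t = 0 ->
  0 <= s <= 2 * t -> sin s <= sin t + cos t * (s - t).
Proof.
move=> /andP[tp1 tp2] e /andP[s0 st]; have p0 := @pi_gt0 R.
pose K s : R := sin t + cos t * (s - t) - sin s.
have dK x : is_derive x 1 K (cos t - cos x).
  by apply: trigger_derive; rewrite /GRing.scale /=; ring.
suff : 0 <= K s by rewrite /K; lra.
have Kt : K t = 0 by rewrite /K; ring.
have K2t : K (2 * t) = 0 by move: e; rewrite /K /stationary; lra.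
have tpi : 0 <= t <= pi by apply/andP; split; lra.
have [h1|h1] := leP s t.
  rewrite -Kt; apply: (ge_of_derive_le0 dK) => // x /andP[sx xt].
  rewrite subr_le0 leNgt ltr_cos ?in_itv/= -?leNgt;
    by try (apply/andP; split); lra.
have [h2|h2] := leP s (2 * pi - t).
  rewrite -Kt; apply: (le_of_derive_ge0 dK) => [|x /andP[sx xt]]; first lra.
  by rewrite subr_ge0; apply: cos_le_between => //; apply/andP; split; lra.
rewrite -K2t; apply: (ge_of_derive_le0 dK) => // x /andP[sx xt].
by rewrite subr_le0; apply: cos_ge_outside => //; apply/andP; split; lra.
Qed.

Lemma potential_add_mixed t x y : pi / 2 <= t -> cos t <= - (1 / 2) ->
  stationary t = 0 -> 0 <= x <= t -> t <= y <= pi ->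
  sin (x + y) <= potential t x + potential t y.
Proof.
move=> tp1 ct e /andP[x0 xt] /andP[ty yp].
rewrite (potential_ge_root e ty) /potential xt.
have p0 := @pi_gt0 R.
pose D x : R := sin t / 2 + cos t * (x - t / 2) + sin (2 * y) / 2 - sin (x + y).
have dD z : is_derive z 1 D (cos t - cos (z + y)).
  by apply: trigger_derive; rewrite /GRing.scale /=; ring.
suff : 0 <= D x by rewrite /D; lra.
have tpi : 0 <= t <= pi by apply/andP; split; lra.
have [h|h] := leP (x + y) (2 * pi - t).
  (* Here [t <= z + y <= 2 * pi - t] for [z] in [[0, x]], so [D] increases and [x = 0] is the worst
     case. *)
  apply: (@le_trans _ _ (D 0)); last first.
    apply: (le_of_derive_ge0 dD) => // z /andP[zx zt].
    by rewrite subr_ge0; apply: cos_le_between => //; apply/andP; split; lra.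
  (* By stationarity [D 0 = G y - G t], and [G' = (2 * cos z + 1) * (cos z - 1)] is nonnegative when
     [cos z <= - (1 / 2)]. *)
  pose G y : R := sin (2 * y) / 2 - sin y.
  have dG z : is_derive z 1 G (cos (2 * z) - cos z).
    by apply: trigger_derive; rewrite /GRing.scale /=; field.
  have : G t <= G y.
    apply: (le_of_derive_ge0 dG) => // z /andP[zx zt].
    have cz : cos z <= cos t.
      by apply: cos_le_between => //; apply/andP; split; lra.
    have := cos_geN1 z; rewrite cos2x; nra.
  move: e; rewrite /D /G /stationary !add0r; lra.
(* Past [2 * pi - t] the function [D] decreases, so [x = t] is the worst case; there stationarity
   turns the affine part into [sin (2 * t) / 2]. *)
apply: (@le_trans _ _ (D t)); last first.
  apply: (ge_of_derive_le0 dD) => // z /andP[zx zt].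
  by rewrite subr_le0; apply: cos_ge_outside => //; apply/andP; split; lra.
have : sin (t + y) <= sin (2 * t) / 2 + sin (2 * y) / 2.
  by apply: sin2D_ge; apply/andP; split; lra.
move: e; rewrite /D /stationary; lra.
Qed.

Lemma potential_add t x y : pi / 2 <= t -> cos t <= - (1 / 2) ->
  stationary t = 0 -> t <= pi -> 0 <= x <= pi -> 0 <= y <= pi ->
  sin (x + y) <= potential t x + potential t y.
Proof.
move=> tp1 ct e tpi /andP[x0 xp] /andP[y0 yp].
have [xt|/ltW xt] := leP x t; have [yt|/ltW yt] := leP y t.
- have := @sin_le_tangent t (x + y); rewrite tp1 tpi => /(_ isT e).
  rewrite /potential xt yt => H.
  have : sin (x + y) <= sin t + cos t * (x + y - t).
    by apply: H; apply/andP; split; lra.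
  lra.
- by apply: potential_add_mixed => //; apply/andP.
- by rewrite addrC [leRHS]addrC; apply: potential_add_mixed => //; apply/andP.
- rewrite !potential_ge_root //; apply: sin2D_ge; apply/andP; split; lra.
Qed.

Lemma potential_add_eq t x : 0 <= x <= t ->
  sin t = potential t x + potential t (t - x).
Proof.
move=> /andP[x0 xt]; rewrite /potential xt.
have -> : t - x <= t by lra.
lra.
Qed.

(** * Signs of [stationary] at two rational multiples of [pi] *)

(** Reflection moves the evaluation points into the first quadrant, where all factors are
    nonnegative and products can be bounded factor by factor. *)
Lemma stationary_pi_sub u :
  stationary (pi - u) = (pi - u) * cos u - sin u * (2 * cos u + 1).
Proof.
rewrite /stationary sin2x.
have -> : cos (pi - u) = - cos u by rewrite cosB cospi sinpi; ring.
have -> : sin (pi - u) = sin u by rewrite sinB cospi sinpi; ring.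
ring.
Qed.

Lemma stationary_pi_sub_lt0 p a s c d u :
  (pi : R) <= p -> 0 <= a -> a <= u <= pi ->
  0 <= s <= sin u -> 0 <= c <= cos u -> cos u <= d ->
  (p - a) * d < s * (2 * c + 1) -> stationary (pi - u) < 0.
Proof.
move=> pp a0 /andP[au up] /andP[s0 su] /andP[c0 cu] ud H.
rewrite stationary_pi_sub subr_lt0.
apply: le_lt_trans (lt_le_trans H _); first by apply: ler_pM; lra.
by apply: ler_pM; lra.
Qed.

Lemma stationary_pi_sub_gt0 p b s c d u : p <= (pi : R) -> u <= b <= p ->
  0 <= sin u <= s -> 0 <= c <= cos u -> cos u <= d ->
  s * (2 * d + 1) < (p - b) * c -> 0 < stationary (pi - u).
Proof.
move=> pp /andP[ub bp] /andP[s0 su] /andP[c0 cu] ud H.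
rewrite stationary_pi_sub subr_gt0.
apply: le_lt_trans (lt_le_trans H _); first by apply: ler_pM; lra.
by apply: ler_pM; lra.
Qed.

End Potential.

Section Root.
Context {R : realType}.
Implicit Types (f df : R -> R) (a b c t x y z : R).

(* The interval contains [pi * (1 - b)] for [b = 0.7541996008265628], the lower
   end of the claimed range of [beta]; below, for the upper end. *)
Lemma sin_cos_lower (u : R) :
  772204728292708992%:R / 10 ^+ 18 <= u <= 772204728292708995%:R / 10 ^+ 18 ->
  697716343414259102%:R / 10 ^+ 18 <= sin u <=
    697716343414259108%:R / 10 ^+ 18 /\
  716374136979159551%:R / 10 ^+ 18 <= cos u <=
    716374136979159558%:R / 10 ^+ 18.
Proof.
have pi2 := @pi_ge2 R; move=> hu.
(* Nine and ten series terms give the required 18-digit precision at this argument. *)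
refine (sin_cos_enclosure (n := 4) _ _ hu _ _ _ _).
all: rewrite ?[maclaurin_horner _ _ _]/=; clear hu; lra.
Qed.

Lemma sin_cos_upper (u : R) :
  772204728292702709%:R / 10 ^+ 18 <= u <= 772204728292702711%:R / 10 ^+ 18 ->
  697716343414254601%:R / 10 ^+ 18 <= sin u <=
    697716343414254606%:R / 10 ^+ 18 /\
  716374136979163936%:R / 10 ^+ 18 <= cos u <=
    716374136979163941%:R / 10 ^+ 18.
Proof.
have pi2 := @pi_ge2 R; move=> hu.
refine (sin_cos_enclosure (n := 4) _ _ hu _ _ _ _).
all: rewrite ?[maclaurin_horner _ _ _]/=; clear hu; lra.
Qed.

Lemma stationary_lower :
  stationary (pi * (7541996008265628%:R / 10 ^+ 16) : R) < 0.
Proof.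
have /andP[p1 p2] := @pi_bounds R.
(* The existential makes [u] an opaque variable, tied to [pi] only by [uE]. *)
have [u uE] : exists u : R, u = pi * (1 - 7541996008265628%:R / 10 ^+ 16).
  by eexists.
have -> : pi * (7541996008265628%:R / 10 ^+ 16) = pi - u by rewrite uE; ring.
have ua : 772204728292708992%:R / 10 ^+ 18 <= u by lra.
have ub : u <= 772204728292708995%:R / 10 ^+ 18 by lra.
have [|/andP[sl su] /andP[cl cu]] := @sin_cos_lower u; first exact/andP.
apply: (stationary_pi_sub_lt0 p2 _ (introT andP (conj ua _))
  (introT andP (conj _ sl)) (introT andP (conj _ cl)) cu);
  move: p1 p2 ub {uE sl su cl cu}; lra.
Qed.

(** The cosine bound allows the monotonicity of [stationary] to start at this endpoint; on the lower
    side it starts at the root itself. *)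
Lemma stationary_upper :
  0 < stationary (pi * (7541996008265648%:R / 10 ^+ 16) : R) /\
  cos (pi * (7541996008265648%:R / 10 ^+ 16) : R) <= - (1 / 2).
Proof.
have /andP[p1 p2] := @pi_bounds R.
have [u uE] : exists u : R, u = pi * (1 - 7541996008265648%:R / 10 ^+ 16).
  by eexists.
have -> : pi * (7541996008265648%:R / 10 ^+ 16) = pi - u by rewrite uE; ring.
have ua : 772204728292702709%:R / 10 ^+ 18 <= u by lra.
have ub : u <= 772204728292702711%:R / 10 ^+ 18 by lra.
have [|/andP[sl su] /andP[cl cu]] := @sin_cos_upper u; first exact/andP.
split; last first.
  have -> : cos (pi - u) = - cos u by rewrite cosB cospi sinpi; ring.
  by move: cl {p1 p2 uE ua ub sl su cu}; lra.
apply: (stationary_pi_sub_gt0 p1 (introT andP (conj ub _))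
  (introT andP (conj _ su)) (introT andP (conj _ cl)) cu);
  move: p1 p2 sl {uE ua ub su cl cu}; lra.
Qed.

(** * Existence, uniqueness and numerical value of [beta] *)

Lemma pi_lt32 : (pi : R) < 32 / 10.
Proof. by have /andP[_ h] := @pi_bounds R; lra. Qed.

Lemma beta_specE b : beta_spec b <-> 0 < b < 1 /\ stationary (pi * b) = 0.
Proof.
rewrite /beta_spec /stationary -mulrA.
by split=> -[b01 e]; split=> //; lra.
Qed.

Lemma beta_spec_cos b : beta_spec b -> cos (pi * b) < - (1 / 2).
Proof.
move=> /beta_specE[/andP[b0 b1] e]; have p0 := @pi_gt0 R.
apply: stationary_root_cos => //; first exact: pi_lt32.
by apply/andP; split; nra.
Qed.

(** A root outside the two endpoints would, by monotonicity, contradict the sign of [stationary] at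
    one of them. The endpoints lie ten units of the last digit away from the stated value. *)
Lemma beta_spec_approx b : beta_spec b ->
  `|b - 7541996008265638%:R / 10 ^+ 16| < 10 ^- 15.
Proof.
move=> hb; have cb := ltW (beta_spec_cos hb).
have /beta_specE[/andP[b0 b1] e] := hb; have p0 := @pi_gt0 R.
have pb0 : 0 < pi * b by rewrite mulr_gt0.
have pb1 : pi * b <= pi by nra.
have lb : 7541996008265628%:R / 10 ^+ 16 < b.
  rewrite ltNge; apply/negP => h; have := stationary_lower.
  apply/negP; rewrite -leNgt -e; apply: stationary_le => //.
  - exact: ltW.
  - by rewrite ler_pM2l.
  - by rewrite ger_pMr//; lra.
have ub : b < 7541996008265648%:R / 10 ^+ 16.
  rewrite ltNge; apply/negP => h; have [] := stationary_upper.
  move=> + c; apply/negP; rewrite -leNgt -e; apply: stationary_le => //.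
  - by apply: mulr_ge0; [exact: ltW|lra].
  - by rewrite ler_pM2l.
by rewrite ltr_norml; apply/andP; split; lra.
Qed.

Lemma continuous_stationary : continuous (stationary : R -> R).
Proof. by move=> t; apply/differentiable_continuous/derivable1_diffP. Qed.

Lemma beta_spec_exists_between (l u : R) : 0 < l -> l <= u -> u < 1 ->
  stationary (pi * l) < 0 -> 0 < stationary (pi * u) ->
  exists b : R, beta_spec b.
Proof.
move=> l0 lu u1 sl su; have p0 := @pi_gt0 R.
have [] := @IVT R stationary (pi * l) (pi * u) 0.
- by rewrite ler_pM2l.
- exact/continuous_subspaceT/continuous_stationary.
- by rewrite ge_min le_max (ltW sl) (ltW su) orbT.
move=> t; rewrite in_itv/= => /andP[t1 t2] e.
exists (t / pi); apply/beta_specE.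
rewrite mulrCA divff ?gt_eqF// mulr1 e; split=> //.
have t0 : 0 < t by apply: lt_le_trans t1; rewrite mulr_gt0.
have tpi : t < pi by apply: le_lt_trans t2 _; rewrite gtr_pMr.
by rewrite divr_gt0// ltr_pdivrMr// mul1r.
Qed.

Lemma beta_spec_exists : exists b : R, beta_spec b.
Proof.
have [su _] := stationary_upper.
apply: (beta_spec_exists_between _ _ _ stationary_lower su); clear su; lra.
Qed.

Lemma beta_spec_unique b c : beta_spec b -> beta_spec c -> b = c.
Proof.
have p0 := @pi_gt0 R.
wlog bc : b c / b < c.
  by move=> h hb hc; have [/h->|/h->|] := ltgtP b c.
move=> hb /beta_specE[/andP[c0 c1] ec]; have cb := ltW (beta_spec_cos hb).
have /beta_specE[/andP[b0 b1] eb] := hb.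
have := @stationary_lt R (pi * b) (pi * c); rewrite eb ec ltxx.
rewrite ltr_pM2l// bc cb; move=> h; suff : false by [].
by apply: h => //; [rewrite mulr_ge0 ?ltW|nra].
Qed.

End Root.

(** * Lebesgue measure, marginals and the law of [(U, Gamma U)] *)

Section Transport.
Context {R : realType}.
Implicit Types (A : set R) (b : R) (gamma : probability (R * R)%type R).

(** The pushforward under the reflection gives half-open intervals their length, which characterizes
    Lebesgue measure. *)
Lemma lebesgue_measure_reflect b A : measurable A ->
  lebesgue_measure ((fun x : R => b - x) @^-1` A) = lebesgue_measure A.
Proof.
move=> mA.
have mf : measurable_fun [set: R] (fun x : R => b - x).
  exact: measurable_funB.
pose mu := [the measure (measurableTypeR R) R of
  @pushforward _ _ (measurableTypeR R) (measurableTypeR R) R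
    (@lebesgue_measure R) (fun x : R => b - x)].
rewrite [RHS](@lebesgue_measure_unique _ (mu mf))// => X -[[x y] /= _ <-].
rewrite /pushforward /=.
have -> : (fun x : R => b - x) @^-1` `]x, y]%classic = `[b - y, b - x[%classic.
  apply/seteqP; split=> z /=; rewrite !in_itv/= => /andP[? ?];
    by apply/andP; split; lra.
rewrite !lebesgue_measure_itv/= !lte_fin ltrD2l ltrN2.
by case: ifPn => // _; rewrite -!EFinD; congr (_%:E); ring.
Qed.

Lemma uniform_prob01E A : measurable A ->
  uniform_prob (@ltr01 R) A = lebesgue_measure (A `&` `[0, 1]).
Proof.
move=> mA; rewrite /uniform_prob integral_uniform_pdf.
rewrite (eq_integral (cst 1%E)); last first.
  move=> x; rewrite inE/= in_itv/= => -[_ x01].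
  by rewrite /uniform_pdf x01 subr0 invr1.
by rewrite integral_cst ?mul1e//; exact: measurableI.
Qed.

Lemma measurable_unit_square : measurable (@unit_square R).
Proof. exact: measurableX. Qed.

Lemma unit_square_null gamma : gamma (@unit_square R) = 1%E ->
  gamma (~` @unit_square R) = 0%E.
Proof.
move=> g1; rewrite probability_setC; last exact: measurable_unit_square.
by rewrite g1 subee.
Qed.

Lemma measure_unit_squareI gamma B : gamma (@unit_square R) = 1%E ->
  measurable B -> gamma (B `&` @unit_square R) = gamma B.
Proof.
move=> g1 mB; have mS := measurable_unit_square.
rewrite -[in RHS](setUIDK B (@unit_square R)) setDE measureU0//.
- exact: measurableI.
- by apply: measurableI => //; exact: measurableC.
- apply: subset_measure0 (unit_square_null g1) => //.
  + by apply: measurableI => //; exact: measurableC.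
  + exact: measurableC.
Qed.

(** Full mass on the square turns the condition on strips over subsets of [[0, 1]] into an identity
    between laws on the line, as needed for a change of variables. *)
Lemma marginal_fst gamma A : uniform_marginals gamma -> measurable A ->
  gamma (fst @^-1` A) = uniform_prob (@ltr01 R) A.
Proof.
move=> [g1 gm] mA; rewrite uniform_prob01E//.
have mA1 : measurable (A `&` `[0, 1]%classic) by exact: measurableI.
have mP : measurable (@fst R R @^-1` A).
  by rewrite -[X in measurable X]setTI; exact: measurable_fst.
rewrite -(gm _ mA1 (@subIsetr _ _ _)).1 -(measure_unit_squareI g1 mP).
congr (gamma _); rewrite /unit_square; apply/seteqP; split=> -[x y] /=; tauto.
Qed.

Lemma marginal_snd gamma A : uniform_marginals gamma -> measurable A ->
  gamma (snd @^-1` A) = uniform_prob (@ltr01 R) A.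
Proof.
move=> [g1 gm] mA; rewrite uniform_prob01E//.
have mA1 : measurable (A `&` `[0, 1]%classic) by exact: measurableI.
have mP : measurable (@snd R R @^-1` A).
  by rewrite -[X in measurable X]setTI; exact: measurable_snd.
rewrite -(gm _ mA1 (@subIsetr _ _ _)).2 -(measure_unit_squareI g1 mP).
congr (gamma _); rewrite /unit_square; apply/seteqP; split=> -[x y] /=; tauto.
Qed.

Lemma lebesgue_measure_setUI1 A (B : set R) c :
  measurable A -> measurable B ->
  lebesgue_measure (A `|` (B `&` [set c])) = lebesgue_measure A.
Proof.
move=> mA mB; have mBc : measurable (B `&` [set c]) by exact: measurableI.
apply: measureU0 => //; apply: subset_measure0 (lebesgue_measure_set1 c) => //.
Qed.

(** The reflection maps [[0, b[] onto []0, b]]; exchanging the endpoints costs only null sets. *)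
Lemma lebesgue_measure_half_open b A : 0 < b -> measurable A ->
  lebesgue_measure (A `&` `]0, b]%classic) =
  lebesgue_measure (A `&` `[0, b[%classic).
Proof.
move=> b0 mA.
have mAb : measurable (A `&` `]0, b[%classic) by exact: measurableI.
have -> : A `&` `]0, b]%classic = A `&` `]0, b[%classic `|` (A `&` [set b]).
  by rewrite -setIUr setUitv1.
have -> : A `&` `[0, b[%classic = A `&` `]0, b[%classic `|` (A `&` [set 0]).
  by rewrite -setIUr setUC setU1itv.
by rewrite !lebesgue_measure_setUI1.
Qed.

(** [Gamma b] preserves measure on [[0, 1]]: it reflects [[0, b[] and fixes [[b, 1]]. *)
Lemma lebesgue_measure_Gamma b A : 0 < b < 1 -> measurable A ->
  lebesgue_measure (`[0, 1]%classic `&` Gamma b @^-1` A) =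
  lebesgue_measure (A `&` `[0, 1]%classic).
Proof.
move=> /andP[b0 b1] mA.
have mAb : measurable (A `&` `]0, b]%classic) by exact: measurableI.
have mA1 : measurable (A `&` `[b, 1]%classic) by exact: measurableI.
have -> : `[0, 1]%classic `&` Gamma b @^-1` A =
    ((fun x : R => b - x) @^-1` (A `&` `]0, b]%classic)) `|`
    (A `&` `[b, 1]%classic).
  apply/seteqP; split=> x /=; rewrite /Gamma !in_itv/=.
    move=> [/andP[x0 x1]]; case: ifPn => [/andP[_ xb] ?|].
      by left; split=> //; apply/andP; split; lra.
    by rewrite x0/= -leNgt => bx ?; right; split=> //; rewrite bx x1.
  move=> [[Ax /andP[x0 xb]]|[Ax /andP[x0 x1]]].
    have -> : 0 <= x < b by apply/andP; split; lra.
    by split=> //; apply/andP; split; lra.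
  have -> : (0 <= x < b) = false.
    by apply/negbTE; rewrite negb_and -!leNgt x0 orbT.
  by split=> //; apply/andP; split; lra.
have -> : A `&` `[0, 1]%classic =
    (A `&` `[0, b[%classic) `|` (A `&` `[b, 1]%classic).
  rewrite -setIUr; congr (_ `&` _); apply/esym.
  by rewrite -itv_bndbnd_setU// bnd_simp ltW.
have mR : measurable ((fun x : R => b - x) @^-1` (A `&` `]0, b]%classic)).
  by rewrite -[X in measurable X]setTI; exact: measurable_funB.
have mAb' : measurable (A `&` `[0, b[%classic) by exact: measurableI.
rewrite !measureU//.
- congr (_ + _)%E; apply: etrans (lebesgue_measure_half_open b0 mA).
  exact: lebesgue_measure_reflect.
- apply/seteqP; split=> // x /=; rewrite !in_itv/=.
  by move=> [[_ /andP[_ xb]] [_ /andP[bx _]]]; lra.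
- apply/seteqP; split=> // x /=; rewrite !in_itv/=.
  by move=> [[_ /andP[xb _]] [_ /andP[bx _]]]; lra.
Qed.

Lemma Gamma_unit b x : 0 < b < 1 -> 0 <= x <= 1 -> 0 <= Gamma b x <= 1.
Proof.
move=> /andP[b0 b1] /andP[x0 x1]; rewrite /Gamma.
by case: ifPn => [/andP[_ xb]|_]; apply/andP; split; lra.
Qed.

(** Each condition becomes an event about [U] alone, the first two because [Gamma b] maps [[0, 1]]
    into itself. *)
Lemma uniform_marginals_Gamma b d (T : measurableType d) (P : probability T R)
    (U : {RV P >-> R}) : 0 < b < 1 ->
  (forall A : set R, measurable A ->
     distribution P U A = uniform_prob (@ltr01 R) A) ->
  uniform_marginals (distribution P (random_vector b U)).
Proof.
move=> b01 hU.
have PU B : measurable B -> P (U @^-1` B) = lebesgue_measure (B `&` `[0, 1]).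
  by move=> mB; rewrite -uniform_prob01E// -hU.
have UG w : 0 <= U w <= 1 -> 0 <= Gamma b (U w) <= 1 by exact: Gamma_unit.
have PV B : distribution P (random_vector b U) B =
    P [set w | B (U w, Gamma b (U w))] by [].
split=> [|A mA A01]; last split.
- apply: (etrans (PV _)); rewrite (_ : [set w | _] = U @^-1` `[0, 1]%classic).
    by rewrite PU// setIid lebesgue_measure_itv/= lte_fin ltr01 -EFinB subr0.
  apply/seteqP; split=> w; rewrite /unit_square /= !in_itv/=; first by case.
  by move=> h; split=> //; exact: UG.
- apply: (etrans (PV _)); rewrite (_ : [set w | _] = U @^-1` A).
    by rewrite PU// (setIidl A01).
  apply/seteqP; split=> w; rewrite /= !in_itv/=; first by case.
  by move=> h; split=> //; apply: UG; have := A01 _ h; rewrite /= in_itv.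
- apply: (etrans (PV _)); rewrite (_ : [set w | _] =
    U @^-1` (`[0, 1]%classic `&` Gamma b @^-1` A))//.
  rewrite PU.
    by rewrite setIAC setIid lebesgue_measure_Gamma// (setIidl A01).
  apply: measurableI => //.
  by rewrite -[X in measurable X]setTI; exact: measurable_Gamma.
Qed.

(** * Integration of the dual inequality *)

(** The cutoff outside [[0, 1]] makes the function bounded on the line, hence integrable for every
    probability. *)
Definition dual_potential b x : R :=
  if 0 <= x <= 1 then potential (pi * b) (pi * x) else 0.

Lemma measurable_dual_potential b : measurable_fun [set: R] (dual_potential b).
Proof.
have mpi : measurable_fun [set: R] (fun x : R => pi * x).
  exact: measurable_funM.
have msin : measurable_fun [set: R] (@sin R).
  by apply: continuous_measurable_fun; exact: continuous_sin.
apply: measurable_fun_ifT => //.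
  by apply: measurable_and; exact: measurable_fun_ler.
apply: measurable_fun_ifT.
- exact: measurable_fun_ler.
- apply: measurable_funD => //; apply: measurable_funM => //.
  exact: measurable_funB.
- apply: measurable_funM => //; apply: measurableT_comp => //.
  exact: measurable_funM.
Qed.

Lemma dual_potential_bound b x : 0 < b < 1 ->
  `|dual_potential b x| <= 1 / 2 + pi.
Proof.
move=> /andP[b0 b1]; have p0 := @pi_gt0 R; rewrite /dual_potential /potential.
case: ifPn => [/andP[x0 x1]|_]; last by rewrite normr0; lra.
have h y : `|sin y / 2| <= 1 / 2 :> R.
  by rewrite normrM (ger0_norm (_ : 0 <= 2^-1))//; have := sin_max y; lra.
case: ifPn => _; last by apply: le_trans (h _) _; lra.
apply: le_trans (ler_normD _ _) (lerD (h _) _).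
rewrite normrM -[leRHS]mul1r; apply: ler_pM => //; first exact: cos_max.
by rewrite ler_norml; apply/andP; split; nra.
Qed.

Lemma cost_le_dual_potential b x y : beta_spec b ->
  0 <= x <= 1 -> 0 <= y <= 1 ->
  cost x y <= dual_potential b x + dual_potential b y.
Proof.
move=> hb x01 y01; have cb := beta_spec_cos hb.
have /beta_specE[/andP[b0 b1] e] := hb; have p0 := @pi_gt0 R.
rewrite /cost /dual_potential x01 y01 mulrDr.
(* Otherwise [cos (pi * b)] would be nonnegative. *)
have pib : pi / 2 <= pi * b.
  rewrite leNgt; apply/negP => h; have : 0 <= cos (pi * b).
    by apply: cos_ge0_pihalf; apply/andP; split; nra.
  lra.
move: x01 y01 => /andP[x0 x1] /andP[y0 y1].
apply: potential_add => //; first exact: ltW; first nra.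
- by apply/andP; split; nra.
- by apply/andP; split; nra.
Qed.

(** Complementary slackness: on [[0, b[] the cost is constantly [sin (pi * b)]; on [[b, 1]] both
    sides are [sin (2 * (pi * x))]. *)
Lemma cost_Gamma b x : beta_spec b -> 0 <= x <= 1 ->
  cost x (Gamma b x) = dual_potential b x + dual_potential b (Gamma b x).
Proof.
move=> hb x01; have /beta_specE[b01 e] := hb; have p0 := @pi_gt0 R.
rewrite /cost /dual_potential x01 Gamma_unit// mulrDr.
move: x01 b01; rewrite /Gamma => /andP[x0 x1] /andP[b0 b1].
case: ifPn => [/andP[_ xb]|].
  rewrite mulrBr -potential_add_eq; first by congr sin; ring.
  by apply/andP; split; nra.
rewrite x0/= -leNgt => bx.
rewrite potential_ge_root//; last by rewrite ler_pM2l.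
have -> : pi * x + pi * x = 2 * (pi * x) by ring.
by field.
Qed.

Lemma integrable_bounded d (T : measurableType d) (P : probability T R)
    (D : set T) (f : T -> R) (M : R) : measurable D ->
  measurable_fun [set: T] f -> (forall x, `|f x| <= M) ->
  P.-integrable D (EFin \o f).
Proof.
move=> mD mf fM; apply: measurable_bounded_integrable => //.
- by rewrite (le_lt_trans (probability_le1 P mD))// ltry.
- exact: measurable_funTS.
- exists M; split; first exact: num_real.
  by move=> y My x _; apply: le_trans (fM x) (ltW My).
Qed.

(** The square may be replaced by the whole plane, its complement being null; then the integral is
    pushed forward along [p], a coordinate projection in the applications. *)
Lemma integral_marginal gamma (nu : probability R R) (f : R -> R) (M : R)
    (p : R * R -> R) : gamma (@unit_square R) = 1%E ->
  measurable_fun [set: R * R] p ->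
  (forall A, measurable A -> gamma (p @^-1` A) = nu A) ->
  measurable_fun [set: R] f -> (forall x, `|f x| <= M) ->
  (\int[gamma]_(z in @unit_square R) (f (p z))%:E =
   \int[nu]_x (f x)%:E)%E.
Proof.
move=> g1 mp hp mf fM; have mS := measurable_unit_square.
have mfp : measurable_fun [set: R * R] (f \o p) by exact: measurableT_comp.
have ifp : gamma.-integrable [set: R * R] (EFin \o (f \o p)).
  exact: (integrable_bounded _ measurableT mfp (fun z => fM (p z))).
have := negligible_integral (measurableC mS) measurableT ifp
  (unit_square_null g1).
rewrite setTD setCK => <-.
transitivity (\int[pushforward gamma p]_x (f x)%:E)%E.
  by rewrite integral_pushforward//; exact/measurable_EFinP.
pose mu := [the measure R R of @pushforward _ _ _ R R gamma p].
exact: (@eq_measure_integral _ _ _ setT nu (mu mp) (EFin \o f)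
  (fun A mA _ => hp A mA)).
Qed.

(** The value is the same for all copulas. The measure [nu] stands for the uniform law and is
    finally taken to be the law of [U]. *)
Lemma integral_dual_potential b gamma (nu : probability R R) : 0 < b < 1 ->
  (forall A : set R, measurable A -> nu A = uniform_prob (@ltr01 R) A) ->
  uniform_marginals gamma ->
  (\int[gamma]_(z in @unit_square R)
     (dual_potential b z.1 + dual_potential b z.2)%:E =
   \int[nu]_x (dual_potential b x)%:E +
   \int[nu]_x (dual_potential b x)%:E)%E.
Proof.
move=> b01 hnu hg; have mS := measurable_unit_square.
have mh := measurable_dual_potential b.
have hM x := dual_potential_bound x b01.
under eq_integral do rewrite EFinD.
rewrite integralD//.
- congr (_ + _)%E; apply: (@integral_marginal _ _ _ (1 / 2 + pi)) => //;
    by [exact: hg.1|move=> A mA; rewrite hnu//; exact: marginal_fst|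
        move=> A mA; rewrite hnu//; exact: marginal_snd].
- apply: (@integrable_bounded _ _ _ _ (dual_potential b \o fst)
    (1 / 2 + pi)) => //.
  + exact: measurableT_comp.
  + by move=> z; exact: hM.
- apply: (@integrable_bounded _ _ _ _ (dual_potential b \o snd)
    (1 / 2 + pi)) => //.
  + exact: measurableT_comp.
  + by move=> z; exact: hM.
Qed.

Lemma measurable_cost : measurable_fun [set: R * R] (fun z => cost z.1 z.2).
Proof.
apply: measurableT_comp.
  by apply: continuous_measurable_fun; exact: continuous_sin.
by apply: measurable_funM => //; exact: measurable_funD.
Qed.

Lemma integrable_cost gamma :
  gamma.-integrable (@unit_square R) (fun z => (cost z.1 z.2)%:E).
Proof.
apply: (@integrable_bounded _ _ _ _ (fun z : R * R => cost z.1 z.2) 1).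
- exact: measurable_unit_square.
- exact: measurable_cost.
- by move=> z; exact: sin_max.
Qed.

Lemma integrable_dual_potential b gamma : 0 < b < 1 ->
  gamma.-integrable (@unit_square R)
    (fun z => (dual_potential b z.1 + dual_potential b z.2)%:E).
Proof.
move=> b01; apply: (@integrable_bounded _ _ _ _
  (fun z : R * R => dual_potential b z.1 + dual_potential b z.2)
  ((1 / 2 + pi) + (1 / 2 + pi))).
- exact: measurable_unit_square.
- by apply: measurable_funD; apply: measurableT_comp => //;
    exact: measurable_dual_potential.
- move=> z; apply: le_trans (ler_normD _ _) _.
  by apply: lerD; exact: dual_potential_bound.
Qed.

Lemma integral_cost_le b gamma (nu : probability R R) : beta_spec b ->
  (forall A : set R, measurable A -> nu A = uniform_prob (@ltr01 R) A) ->
  uniform_marginals gamma ->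
  (\int[gamma]_(z in @unit_square R) (cost z.1 z.2)%:E <=
   \int[nu]_x (dual_potential b x)%:E +
   \int[nu]_x (dual_potential b x)%:E)%E.
Proof.
move=> hb hnu hg; have /beta_specE[b01 _] := hb.
rewrite -(integral_dual_potential b01 hnu hg); apply: le_integral.
- exact: measurable_unit_square.
- exact: integrable_cost.
- exact: integrable_dual_potential.
move=> [x y]; rewrite inE /unit_square /= !in_itv/= => -[x01 y01].
by rewrite lee_fin cost_le_dual_potential.
Qed.

Lemma integral_cost_Gamma b d (T : measurableType d) (P : probability T R)
    (U : {RV P >-> R}) (nu : probability R R) : beta_spec b ->
  (forall A : set R, measurable A -> nu A = uniform_prob (@ltr01 R) A) ->
  uniform_marginals (distribution P (random_vector b U)) ->
  (\int[distribution P (random_vector b U)]_(z in @unit_square R)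
     (cost z.1 z.2)%:E =
   \int[nu]_x (dual_potential b x)%:E +
   \int[nu]_x (dual_potential b x)%:E)%E.
Proof.
move=> hb hnu hg; have /beta_specE[b01 _] := hb.
have mV := measurable_random_vector b U; have mS := measurable_unit_square.
have mVS : measurable (random_vector b U @^-1` @unit_square R).
  by rewrite -[X in measurable X]setTI; exact: mV.
rewrite -(integral_dual_potential b01 hnu hg).
(* Both integrals are pulled back to [T], where the integrands agree pointwise by [cost_Gamma]. *)
rewrite !integral_pushforward//.
- apply: eq_integral => w; rewrite inE /unit_square /= !in_itv/= => -[w01 _].
  by rewrite cost_Gamma.
- apply/measurable_EFinP.
  by apply: measurable_funD; apply: measurableT_comp => //;
    exact: measurable_dual_potential.
- apply: (@integrable_bounded _ _ _ _ (fun w => dual_potential b (U w) +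
    dual_potential b (Gamma b (U w))) ((1 / 2 + pi) + (1 / 2 + pi))) => //.
  + apply: measurable_funD; apply: measurableT_comp => //;
      try exact: measurable_dual_potential.
    by apply: measurableT_comp => //; exact: measurable_Gamma.
  + move=> w; apply: le_trans (ler_normD _ _) _.
    by apply: lerD; exact: dual_potential_bound.
- by apply/measurable_EFinP; exact: measurable_cost.
- apply: (@integrable_bounded _ _ _ _ 
    (fun w => cost (U w) (Gamma b (U w))) 1) => //.
  + exact: (measurableT_comp measurable_cost mV).
  + by move=> w; exact: sin_max.
Qed.

End Transport.

Theorem corollary3p8 (R : realType) :
  (exists! beta : R, beta_spec beta) /\
  forall beta : R, beta_spec beta ->
    `|beta - 7541996008265638%:R / 10 ^+ 16| < 10 ^- 15 /\
    forall (d : measure_display) (T : measurableType d) (P : probability T R)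
      (U : {RV P >-> R}),
      (forall A : set R, measurable A ->
         distribution P U A = uniform_prob (@ltr01 R) A) ->
      uniform_marginals (distribution P (random_vector beta U)) /\
      forall gamma : probability (R * R)%type R, uniform_marginals gamma ->
        (\int[gamma]_(z in @unit_square R) (cost z.1 z.2)%:E <=
         \int[distribution P (random_vector beta U)]_(z in @unit_square R)
           (cost z.1 z.2)%:E)%E.
Proof.
split.
  have [b hb] := @beta_spec_exists R.
  by exists b; split=> // c; exact: beta_spec_unique.
move=> b hb; split; first exact: beta_spec_approx.
move=> d T P U hU; have /beta_specE[b01 _] := hb.
have hV := uniform_marginals_Gamma b01 hU; split=> // gamma hg.
(* The law of [(U, Gamma U)] attains the dual value, which bounds the integral for every [gamma]. *)
rewrite (integral_cost_Gamma hb hU hV).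
exact: integral_cost_le hb hU hg.
Qed.
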